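(* Let $\kappa$ be a cardinal and let $X$ be a topological space with topology $\tau$ such that either $\chi(X)<\kappa$, or $\kappa$ is regular and $\chi(p,X)<\kappa$ for each $p\in X$. Then the following are equivalent: (a) $w(X)\ge\kappa$. (b) There are a subspace $Y\subset X$ of size $\kappa$ and a neighbourhood assignment $f:Y\to\tau$ on $Y$ such that $D_G^f$ is right-separated for each open $G\subset X$. (c) There are a subspace $Y\subset X$ of size $\kappa$, a neighbourhood assignment $f:Y\to\tau$ on $Y$ and a regular cardinal $\lambda\le\kappa$ such that, for each open $G\subset X$, $D_G^f$ is the union of fewer than $\lambda$ many pseudo weakly separated subspaces.
   Context: Here $w$ denotes weight, $\chi(p,X)$ the character of the point $p$ in $X$, and $\chi(X)$ the character of $X$; as usual, cardinal functions take only infinite values (and regular cardinals are infinite). Given a topological space $\langle X,\tau\rangle$ and $Y\subset X$, a neighbourhood assignment on $Y$ is a function $f:Y\to\tau$ with $y\in f(y)$ for each $y\in Y$. For such $f$ and a set $N\subset X$, put $D_N^f=\{y\in Y: y\in N\subset f(y)\}$. A space $Z$ is right-separated if it has a well-ordering all of whose initial segments are open in $Z$. A space $Z$ is weakly separated if there is a neighbourhood assignment $g$ on $Z$ such that for all $y\ne z$ in $Z$, $y\notin g(z)$ or $z\notin g(y)$. A space $Z$ is pseudo weakly separated if it contains a weakly separated subspace $Z'$ with $|Z'|=|Z|$.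
   Formalization: The formal theorem assumes in addition that X is nonempty or κ is uncountable; this excludes only the empty space X with κ = ℵ₀, where (a) holds (weights are infinite) but (b) and (c) fail. *)

(* Defs.v *)
From HB Require Import structures.
From mathcomp Require Import all_boot.
From mathcomp Require Import boolp classical_sets functions cardinality wochoice.
From mathcomp Require Import filter topology.

Set Implicit Arguments.
Unset Strict Implicit.
Unset Printing Implicit Defensive.

Local Open Scope classical_set_scope.
Local Open Scope card_scope.

(* A cardinal is represented by a set of that cardinality; cardinals are only
   compared through #<=, #= and the strict order below. *)

Definition card_lt T U (A : set T) (B : set U) : bool :=
  (A #<= B) && ~~ (B #<= A).

Notation "A '#<' B" := (card_lt A B)
  (at level 79, format "A  '#<'  B") : card_scope.

(* The index set and the pieces can be taken in T: being smaller than A, they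
   embed in A. *)
Definition regular_card T (A : set T) : Prop :=
  infinite_set A /\
  forall (I : set T) (F : T -> set T),
    I #< A -> (forall i, I i -> F i #< A) -> \bigcup_(i in I) F i #< A.

Definition is_min_card T (F : set (set T)) (A : set T) : Prop :=
  F A /\ forall B, F B -> A #<= B.

Definition min_card T (F : set (set T)) : set T := xget set0 (is_min_card F).

(* Take a maximal set S of choice functions of F that pairwise differ at every
   member of F: S embeds in each member, and covers one of them. *)
Lemma min_cardP T (F : set (set T)) :
  F !=set0 -> is_min_card F (min_card F).
Proof.
move=> [C FC]; apply: xgetPex.
have [[A [FA A0]]|F0] := pselect (exists A, F A /\ A = set0).
  by exists A; split=> // B _; rewrite A0 card_ge0.
have {}F0 A : F A -> A !=set0.
  by move=> FA; apply/set0P/eqP => A0; apply: F0; exists A.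
pose good (S : set (set T -> T)) :=
  (forall h, S h -> forall A, F A -> A (h A)) /\
  (forall h k, S h -> S k -> forall A, F A -> h A = k A -> h = k).
have [S [[Sin Sinj] Smax]] : exists S, good S /\ forall S', S `<` S' -> ~ good S'.
  apply: (@Zorn_bigcup _ good) => G GP Gtot; split.
    by move=> h [S GS Sh]; exact: (GP _ GS).1.
  move=> h k [S GS Sh] [S' GS' S'k] A FA.
  case: (Gtot _ _ GS GS') => sSS.
    by apply: (GP _ GS').2 => //; apply: sSS.
  by apply: (GP _ GS).2 => //; apply: sSS.
have [[A [FA sA]]|noA] :=
    pselect (exists A, F A /\ A `<=` (fun h => h A) @` S).
  exists A; split=> // B FB.
  apply: (card_le_trans (subset_card_le sA)).
  apply: (card_le_trans (card_image_le _ _)).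
  have : (fun h => h B) @` S #= S.
    by apply: inj_card_eq => h k /set_mem Sh /set_mem Sk; exact: Sinj.
  rewrite card_eq_le => /andP[_ SB]; apply: (card_le_trans SB).
  by apply: subset_card_le => _ [h Sh <-]; exact: (Sin h Sh B FB).
have [c0 _] := F0 _ FC.
have /choice[h hP] : forall A, exists a : T, F A -> A a /\ forall k, S k -> k A <> a.
  move=> A; have [FA|nFA] := pselect (F A); last by exists c0.
  have /existsNP[a /not_implyP[Aa na]] : ~ (A `<=` (fun h => h A) @` S).
    by move=> sA; apply: noA; exists A.
  by exists a => _; split=> // k Sk e; apply: na; exists k.
exfalso; apply: (Smax (S `|` [set h])).
  split; first by move=> k; left.
  by move=> /(_ h (or_intror erefl)) Sh; exact: (hP _ FC).2 _ Sh erefl.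
split.
  by move=> k [Sk|->] A FA; [exact: (Sin k Sk A FA)|exact: (hP _ FA).1].
move=> k l [Sk|->] [Sl|->] A FA //; first exact: Sinj.
  by move=> e; case: ((hP _ FA).2 _ Sk).
by move=> e; case: ((hP _ FA).2 _ Sl).
Qed.

(* |A| + aleph_0: cardinal functions take only infinite values. *)
Definition add_omega T (A : set T) : set (nat + T) :=
  range (@inl nat T) `|` (@inr nat T) @` A.

Section CardinalFunctions.
Context (X : topologicalType).

Definition weight : set (nat + set X) :=
  min_card [set add_omega B | B in @basis X].

Definition local_base (p : X) (B : set (set X)) : Prop :=
  B `<=` open_nbhs p /\ filter_from B id --> p.

Definition character_at (p : X) : set (nat + set X) :=
  min_card [set add_omega B | B in local_base p].

(* The supremum of all character_at p, taken among the infinite cardinals (so it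
   is aleph_0 when X is empty). *)
Definition character : set (nat + set X) :=
  min_card [set S : set (nat + set X) |
    infinite_set S /\ forall p, character_at p #<= S].

Definition nbhd_assignment (Y : set X) (f : X -> set X) : Prop :=
  forall y, Y y -> open_nbhs y (f y).

Definition Dset (Y : set X) (f : X -> set X) (N : set X) : set X :=
  [set y | [/\ Y y, N y & N `<=` f y]].

Lemma weightP : exists2 B, @basis X B & weight = add_omega B /\
  forall B', @basis X B' -> add_omega B #<= add_omega B'.
Proof.
have [] : is_min_card [set add_omega B | B in @basis X] weight.
  apply: min_cardP; exists (add_omega (@open X)), (@open X) => //.
  split=> // x U; rewrite nbhsE => -[V [oV Vx] VU].
  by exists V.
by move=> [B bB <-] h; exists B => //; split=> // B' bB'; apply: h; exists B'.
Qed.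

Lemma character_atP p : exists2 B, local_base p B &
  character_at p = add_omega B /\
  forall B', local_base p B' -> add_omega B #<= add_omega B'.
Proof.
have [] : is_min_card [set add_omega B | B in local_base p] (character_at p).
  apply: min_cardP; exists (add_omega (open_nbhs p)), (open_nbhs p) => //.
  by split=> // U; rewrite nbhsE.
by move=> [B bB <-] h; exists B => //; split=> // B' bB'; apply: h; exists B'.
Qed.

Lemma characterP : [/\ infinite_set character,
  forall p, character_at p #<= character &
  forall S : set (nat + set X), infinite_set S ->
    (forall p, character_at p #<= S) -> character #<= S].
Proof.
have [] : is_min_card [set S : set (nat + set X) |
    infinite_set S /\ forall p, character_at p #<= S] character.
  apply: min_cardP; exists setT; split; last first.
    by move=> p; apply: subset_card_le.
  apply/infiniteP.
  apply: card_le_trans (subset_card_le (@subsetT _ (range inl))).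
  have : range (@inl nat (set X)) #= [set: nat].
    by apply: inj_card_eq => ? ? _ _ [].
  by rewrite card_eq_le => /andP[].
by move=> [? ?] h; split=> // S ? ?; apply: h.
Qed.

End CardinalFunctions.

Arguments weight : clear implicits.
Arguments character : clear implicits.

(* A subset A of X, used as a space, is the type set_type A with its subspace
   topology. *)

Definition right_separated (Z : topologicalType) : Prop :=
  exists2 R : rel Z, well_order R &
    forall S : set Z, (forall x y, S y -> R x y -> S x) -> open S.

Definition weakly_separated (Z : topologicalType) : Prop :=
  exists2 g : Z -> set Z, nbhd_assignment [set: Z] g &
    forall y z : Z, y <> z -> ~ g z y \/ ~ g y z.

Definition pseudo_weakly_separated (Z : topologicalType) : Prop :=
  exists2 A : set Z, weakly_separated (set_type A) & A #= [set: Z].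

(* Main.v *)
Require Import Defs.
From HB Require Import structures.
From mathcomp Require Import all_boot.
From mathcomp Require Import boolp classical_sets functions cardinality.
From mathcomp Require Import wochoice filter topology.

Local Open Scope classical_set_scope.
Local Open Scope card_scope.

(* (a) => (b): fix a local base at each point and recursively choose points y_a
   and neighbourhoods U_a, a < kappa, such that no V in the local base of an
   earlier y_b satisfies y_a \in V `<=` U_a; this is possible because fewer than
   kappa local bases have fewer than kappa members in total and so do not form a
   base.  If V `<=` G is in the local base of y_b, then V misses every later y_a
   with G `<=` U_a, so that initial segments of D_G are open.
   (b) => (c): right-separated spaces are weakly separated; take lambda = aleph_0.
   (c) => (a): a weakly separated subspace has at most w(X) points.  If B is a
   base with |B| < kappa, then Y is the union of the D_G for G in B, hence a union
   of pieces of size at most w(X) that are too few to make up kappa points. *)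

(** * Comparison of cardinals through maps *)

Lemma card_le_inj T U (A : set T) (B : set U) (f : T -> U) :
  (forall x, A x -> B (f x)) ->
  (forall x y, A x -> A y -> f x = f y -> x = y) -> A #<= B.
Proof.
move=> fB finj.
have : f @` A #= A.
  by apply: inj_card_eq => x y /set_mem Ax /set_mem Ay; exact: finj.
rewrite card_eq_le => /andP[_ leAf]; apply: (card_le_trans leAf).
by apply: subset_card_le => _ [x Ax <-]; exact: fB.
Qed.

Lemma card_le_surj T U (A : set T) (B : set U) (f : T -> U) :
  B `<=` f @` A -> B #<= A.
Proof.
by move=> sB; exact: card_le_trans (subset_card_le sB) (card_image_le f A).
Qed.

(** Trades the injection between subtypes behind [#<=] for a function on the whole of [T], which
    later constructions can apply freely; [u] is its junk value outside [A]. *)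
Lemma card_le_fun T U (A : set T) (B : set U) (u : U) : A #<= B ->
  exists f : T -> U, (forall x, A x -> B (f x)) /\
    (forall x y, A x -> A y -> f x = f y -> x = y).
Proof.
move=> /card_leP[g].
have gP x : A x -> exists y : U, B y /\ forall Ax : x \in A, y = val (g (SigSub Ax)).
  move=> Ax; exists (val (g (SigSub (mem_set Ax)))); split.
    exact/set_mem/valP.
  by move=> Ax'; congr (val (g _)); exact: val_inj.
have /choice[f fP] : forall x, exists y : U, A x ->
    B y /\ forall Ax : x \in A, y = val (g (SigSub Ax)).
  move=> x; have [/gP[y yP]|nAx] := pselect (A x); first by exists y.
  by exists u.
exists f; split=> [x Ax|x y Ax Ay]; first exact: (fP x Ax).1.
have [_ /(_ (mem_set Ax)) ->] := fP x Ax.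
have [_ /(_ (mem_set Ay)) ->] := fP y Ay.
move=> /val_inj /(@inj _ _ _ g).
by rewrite !in_setT => /(_ isT isT) /(congr1 val).
Qed.

(** Zorn on the graphs of partial injections from [A] to [B]: if a maximal one missed both a point
    of [A] and a point of [B], that pair could be added. *)
Lemma card_le_total T U (A : set T) (B : set U) : A #<= B \/ B #<= A.
Proof.
pose good (G : set (T * U)) := [/\ G `<=` A `*` B,
  forall u v, G u -> G v -> u.1 = v.1 -> u = v &
  forall u v, G u -> G v -> u.2 = v.2 -> u = v].
have [G [[GAB G1 G2] Gmax]] : exists G, good G /\ forall G', G `<` G' -> ~ good G'.
  apply: (@Zorn_bigcup _ good) => F FP Ftot.
  have two u v : (\bigcup_(X in F) X) u -> (\bigcup_(X in F) X) v ->
      exists2 H, F H & H u /\ H v.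
    move=> [H FH Hu] [H' FH' H'v].
    by case: (Ftot _ _ FH FH') => s; [exists H'|exists H] => //; split=> //; exact: s.
  split.
  - by move=> u [H FH Hu]; have [s _ _] := FP _ FH; exact: s.
  - by move=> u v Fu Fv; have [H /FP[_ inj _] [Hu Hv]] := two _ _ Fu Fv; exact: inj.
  - by move=> u v Fu Fv; have [H /FP[_ _ inj] [Hu Hv]] := two _ _ Fu Fv; exact: inj.
have [sA|/existsNP[a /not_implyP[Aa na]]] := pselect (A `<=` fst @` G).
  left; apply: (card_le_trans (card_le_surj _ _ _ _ _ sA)).
  by apply: (@card_le_inj _ _ _ _ snd) => // u /GAB[].
have [sB|/existsNP[b /not_implyP[Bb nb]]] := pselect (B `<=` snd @` G).
  right; apply: (card_le_trans (card_le_surj _ _ _ _ _ sB)).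
  by apply: (@card_le_inj _ _ _ _ fst) => // u /GAB[].
exfalso; apply: (Gmax (G `|` [set (a, b)])).
  by split=> [|/(_ (a, b) (or_intror erefl)) Gab]; [left|apply: na; exists (a, b)].
split.
- by move=> u [/GAB//|->].
- move=> u v [Gu|->] [Gv|->] //= e; first exact: G1.
    by case: na; exists u.
  by case: na; exists v.
- move=> u v [Gu|->] [Gv|->] //= e; first exact: G2.
    by case: nb; exists u.
  by case: nb; exists v.
Qed.

Lemma card_ltNge T U (A : set T) (B : set U) : (A #< B) = ~~ (B #<= A).
Proof.
rewrite /card_lt; case: (boolP (B #<= A)) => nBA; first by rewrite andbF.
by have [->|BA] := card_le_total _ _ A B; last by rewrite BA in nBA.
Qed.

(** * Products and unions of infinite cardinals; regularity *)

Lemma card_le_setX T T' U U' (A : set T) (A' : set T') (B : set U) (B' : set U') :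
  A #<= A' -> B #<= B' -> A `*` B #<= A' `*` B'.
Proof.
move=> leA leB; have [->|/set0P[[a b] [Aa Bb]]] := eqVneq (A `*` B) set0.
  exact: card_ge0.
have A'0 : A' !=set0.
  apply/set0P; apply: contraTneq leA => ->; rewrite card_le0; apply/set0P.
  by exists a.
have B'0 : B' !=set0.
  apply/set0P; apply: contraTneq leB => ->; rewrite card_le0; apply/set0P.
  by exists b.
case: A'0 B'0 => a' _ [b' _].
have [f [fA finj]] := card_le_fun _ _ _ _ a' leA.
have [g [gB ginj]] := card_le_fun _ _ _ _ b' leB.
apply: (@card_le_inj _ _ _ _ (fun u => (f u.1, g u.2))).
  by move=> [x y] [/= Ax By]; split=> /=; [exact: fA|exact: gB].
move=> [x y] [x' y'] [/= Ax By] [/= Ax' By'] [/finj-> // /ginj-> //].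
Qed.

Lemma infinite_card_leN T U (A : set T) (B : set U) :
  infinite_set A -> A #<= B -> infinite_set B.
Proof. by move=> iA leAB fB; apply: iA; exact: card_le_finite leAB fB. Qed.

(* S has two elements, so A and B embed in disjoint copies of S inside S * S. *)
Lemma card_setU_square T U (A B : set T) (S : set U) : infinite_set S ->
  S `*` S #<= S -> A #<= S -> B #<= S -> A `|` B #<= S.
Proof.
move=> iS SS leA leB; apply: card_le_trans SS.
have [s Ss] := infinite_setN0 iS.
have [t [St st]] : exists t, S t /\ t <> s.
  apply: contrapT => nt; apply: iS; apply: (@sub_finite_set _ _ [set s]).
    by move=> x Sx; apply: contrapT => xs; apply: nt; exists x.
  exact: finite_set1.
have [f [fA finj]] := card_le_fun _ _ _ _ s leA.
have [g [gB ginj]] := card_le_fun _ _ _ _ s leB.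
apply: (@card_le_inj _ _ _ _ (fun x => if pselect (A x) then (s, f x) else (t, g x))).
  move=> x [Ax|Bx]; case: pselect => // Ax'; split=> //=; [exact: fA|exact: fA|exact: gB].
move=> x y ABx ABy; case: pselect => Ax; case: pselect => Ay -[].
- exact: finj.
- by move=> /esym.
- by [].
- by apply: ginj; [case: ABx|case: ABy].
Qed.

(* Zorn on relations G from D * D to D, total and with injective inverse (which
   already gives D * D #<= D), D being infinite.  For a maximal G, |D| = |A|:
   otherwise A minus D contains a copy S' of D, and G extends to D `|` S' since
   the square of that set embeds in S'. *)
Lemma card_setX_idem T (A : set T) : infinite_set A -> A `*` A #<= A.
Proof.
move=> iA.
pose dom (G : set (T * T * T)) := [set a | exists c, G (a, a, c)].
pose good (G : set (T * T * T)) := [/\ G = set0 \/ infinite_set (dom G),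
  dom G `<=` A, forall u v, G u -> G v -> u.2 = v.2 -> u = v,
  forall a b, dom G a -> dom G b -> exists c, G (a, b, c) &
  forall u, G u -> dom G u.2].
have [G [[Ginf GA Ginj Gtot Gdom] Gmax]] :
    exists G, good G /\ forall G', G `<` G' -> ~ good G'.
  apply: (@Zorn_bigcup _ good) => F FP Ftot.
  have domS H : F H -> dom H `<=` dom (\bigcup_(X in F) X).
    by move=> FH a [c Hc]; exists c, H.
  split.
  - have [[H FH H0]|nF] := pselect (exists2 H, F H & H !=set0); last first.
      left; rewrite -subset0 => u [H FH Hu]; apply: nF; exists H => //.
      by exists u.
    right; have [[H0'|iH] _ _ _ _] := FP _ FH.
      by move: H0; rewrite H0' => -[].
    exact: sub_infinite_set (domS _ FH) iH.
  - by move=> a [c [H FH Hc]]; have [_ HA _ _ _] := FP _ FH; apply: HA; exists c.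
  - move=> u v [H FH Hu] [H' FH' H'v].
    case: (Ftot _ _ FH FH') => s.
      by have [_ _ inj _ _] := FP _ FH'; apply: inj => //; exact: s.
    by have [_ _ inj _ _] := FP _ FH; apply: inj => //; exact: s.
  - move=> a b [c [H FH Hc]] [d [H' FH' H'd]].
    case: (Ftot _ _ FH FH') => s.
      have [_ _ _ tot _] := FP _ FH'.
      have [||e H'e] := tot a b; [by exists c; exact: s|by exists d|].
      by exists e, H'.
    have [_ _ _ tot _] := FP _ FH.
    have [||e He] := tot a b; [by exists c|by exists d; exact: s|].
    by exists e, H.
  - move=> u [H FH Hu]; apply: domS (FH) _ _.
    by have [_ _ _ _ Hdom] := FP _ FH; exact: Hdom.
(* The extension step. The new values lie in [S'], outside [dom G], so they never collide with the
   values of [G]. Pairs of [dom G] receive a second value, which is harmless since [G] is only a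
   relation. *)
have ext S' : S' `<=` A `\` dom G -> infinite_set S' ->
    ~ ((dom G `|` S') `*` (dom G `|` S') #<= S').
  move=> sS' iS' le; have [s S's] := infinite_setN0 iS'.
  have [h [hS hinj]] := card_le_fun _ _ _ _ s le.
  pose D := dom G `|` S'.
  pose G' := G `|` [set (p, h p) | p in D `*` D].
  have domG' : dom G' = D.
    apply/seteqP; split=> a.
      by move=> [c [Gc|[p [Da _] [ep _]]]]; [left; exists c|rewrite ep in Da].
    by move=> Da; exists (h (a, a)); right; exists (a, a).
  apply: (Gmax G').
    split=> [u Gu|sGG]; first by left.
    have [_ []] := sS' s S's; exists (h (s, s)).
    by apply: sGG; right; exists (s, s) => //; split; right.
  split; rewrite ?domG'.
  - by right; apply: sub_infinite_set iS'; right.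
  - by move=> a [/GA//|/sS'[]].
  - move=> u v [Gu|[p Dp <-]] [Gv|[q Dq <-]] /= e.
    + exact: Ginj.
    + by have [_ []] := sS' _ (hS _ Dq); rewrite -e; exact: Gdom.
    + by have [_ []] := sS' _ (hS _ Dp); rewrite e; exact: Gdom.
    + by rewrite (hinj p q).
  - by move=> a b Da Db; exists (h (a, b)); right; exists (a, b).
  - by move=> u [/Gdom|[p Dp <-]]; [left|right; exact: hS].
have domdom : dom G `*` dom G #<= dom G.
  apply: (@card_le_trans _ _ _ G).
    by apply: (@card_le_surj _ _ _ _ fst) => -[a b] [/= /Gtot h /h[c Gc]]; exists (a, b, c).
  exact: (@card_le_inj _ _ _ _ snd).
case: Ginf => [G0|iG].
  (* If [G] is empty, a countably infinite subset of [A] can be added to its domain. *)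
  have dG0 : dom G = set0 by rewrite -subset0 G0 => a [].
  exfalso; have /infiniteP leA := iA.
  have [a0 _] := infinite_setN0 iA.
  have [f [fA finj]] := card_le_fun _ _ _ _ a0 leA.
  have e : range f #= [set: nat].
    by apply: inj_card_eq => x y _ _; exact: finj.
  move: (e); rewrite card_eq_le => /andP[leN geN].
  apply: (ext (range f)).
  - by rewrite dG0 setD0 => _ [x _ <-]; exact: fA.
  - exact/infiniteP.
  - rewrite dG0 set0U; apply: (card_le_trans (card_le_setX _ _ _ _ _ _ _ _ leN leN)).
    apply: card_le_trans geN.
    by move: card_nat2; rewrite card_eq_le setXTT => /andP[].
have [le|le] := card_le_total _ _ (A `\` dom G) (dom G).
  have leA : A #<= dom G.
    apply: (@card_le_trans _ _ _ (dom G `|` (A `\` dom G))).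
      by apply: subset_card_le => a Aa; have [|] := pselect (dom G a); [left|right].
    exact: card_setU_square.
  apply: (card_le_trans (card_le_setX _ _ _ _ _ _ _ _ leA leA)).
  exact: card_le_trans domdom (subset_card_le GA).
have [a0 _] := infinite_setN0 iA.
have [f [fA finj]] := card_le_fun _ _ _ _ a0 le.
have : f @` dom G #= dom G.
  by apply: inj_card_eq => x y /set_mem dx /set_mem dy; exact: finj.
rewrite card_eq_le => /andP[leD geD].
exfalso; apply: (ext (f @` dom G)).
- by move=> _ [x dx <-]; exact: fA.
- exact: infinite_card_leN iG geD.
- have leU : dom G `|` f @` dom G #<= dom G by apply: card_setU_square.
  apply: (card_le_trans (card_le_setX _ _ _ _ _ _ _ _ leU leU)).
  exact: card_le_trans domdom geD.
Qed.

Lemma card_setU_le T U (A B : set T) (S : set U) : infinite_set S ->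
  A #<= S -> B #<= S -> A `|` B #<= S.
Proof. by move=> iS; exact/card_setU_square/card_setX_idem. Qed.

(** A point of the union is coded by an index [k x] of a piece containing it and its place in that
    piece; this embeds the union in [S * S]. *)
Lemma card_bigcup_le T U I (D : set I) (F : I -> set T) (S : set U) :
  infinite_set S -> D #<= S -> (forall i, D i -> F i #<= S) ->
  \bigcup_(i in D) F i #<= S.
Proof.
move=> iS leD leF; have [->|/set0P[t0 [i0 Di0 _]]] := eqVneq (\bigcup_(i in D) F i) set0.
  exact: card_ge0.
have [s Ss] := infinite_setN0 iS.
have [d [dS dinj]] := card_le_fun _ _ _ _ s leD.
have /choice[f fP] : forall i, exists f : T -> U, D i ->
    (forall x, F i x -> S (f x)) /\
    (forall x y, F i x -> F i y -> f x = f y -> x = y).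
  move=> i; have [Di|nDi] := pselect (D i); last by exists (fun=> s).
  by have [f fP] := card_le_fun _ _ _ _ s (leF i Di); exists f.
have /choice[k kP] : forall x, exists i, (\bigcup_(i in D) F i) x -> D i /\ F i x.
  move=> x; have [[i Di Fx]|nx] := pselect ((\bigcup_(i in D) F i) x); last by exists i0.
  by exists i.
apply: card_le_trans (card_setX_idem _ _ iS).
apply: (@card_le_inj _ _ _ _ (fun x => (d (k x), f (k x) x))).
  by move=> x /kP[Dk Fk]; split=> /=; [exact: dS|exact: (fP _ Dk).1].
move=> x y /kP[Dx Fx] /kP[Dy Fy] [/dinj]; rewrite -/(k x) => e.
move: (e Dx Dy) Fy => <- Fy; exact: (fP _ Dx).2.
Qed.

Lemma regular_bigcup_lt T U I (A : set T) (D : set I) (F : I -> set U) :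
  regular_card A -> D #< A -> (forall i, D i -> F i #< A) ->
  \bigcup_(i in D) F i #< A.
Proof.
move=> [iA regA] DA FA; rewrite card_ltNge; apply/negP => leA.
have [t0 At0] := infinite_setN0 iA.
have [u0 [i0 Di0 _]] : \bigcup_(i in D) F i !=set0.
  apply/set0P; apply: contraTneq leA => ->; rewrite card_le0; apply/set0P.
  by exists t0.
have [e [eF einj]] := card_le_fun _ _ _ _ u0 leA.
have [d [dA dinj]] := card_le_fun _ _ _ _ t0 (proj1 (andP DA)).
have /choice[r rP] : forall t, exists i, (d @` D) t -> D i /\ d i = t.
  move=> t; have [[i Di dt]|nt] := pselect ((d @` D) t); last by exists i0.
  by exists i.
have dDA : d @` D #< A.
  move: DA; rewrite !card_ltNge; apply: contra => leAD.
  exact: card_le_trans leAD (card_image_le _ _).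
have FrA t : (d @` D) t -> A `&` e @^-1` F (r t) #< A.
  move=> /rP[Dr _]; rewrite card_ltNge.
  move: (FA _ Dr); rewrite card_ltNge; apply: contra => leAF.
  apply: (card_le_trans leAF).
  by apply: (@card_le_inj _ _ _ _ e) => [x []//|x y [Ax _] [Ay _]]; exact: einj.
have := regA _ _ dDA FrA; rewrite card_ltNge => /negP; apply.
apply: subset_card_le => t At; have [i Di Fi] := eF _ At.
have [Dr dr] := rP (d i) (ex_intro2 _ _ i Di erefl).
by exists (d i); [exists i|split=> //=; rewrite (dinj _ _ Dr Di dr)].
Qed.

Lemma card_le_add_omega T (A : set T) : A #<= add_omega A.
Proof.
by apply: (@card_le_inj _ _ _ _ inr) => [a Aa|? ? _ _ []//]; right; exists a.
Qed.

Lemma infinite_add_omega T (A : set T) : infinite_set (add_omega A).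
Proof.
apply/infiniteP/(@card_le_inj _ _ _ _ inl) => [n _|? ? _ _ []//].
by left; exists n.
Qed.

Lemma add_omega_le T U (A : set T) (S : set U) :
  infinite_set S -> A #<= S -> add_omega A #<= S.
Proof.
move=> iS leA; apply: card_setU_le => //.
  by apply: card_le_trans (card_image_le _ _) _; exact/infiniteP.
exact: card_le_trans (card_image_le _ _) leA.
Qed.

Lemma card_le_lt_trans T U V (A : set T) (B : set U) (C : set V) :
  A #<= B -> B #< C -> A #< C.
Proof.
by move=> leAB; rewrite !card_ltNge; apply: contra => /card_le_trans; exact.
Qed.

(** An infinite [A] absorbs the added copy of [nat]; for a finite [A] the result is countable, which
    is why [S] has to be uncountable. *)
Lemma add_omega_lt T U (A : set T) (S : set U) :
  [set: nat] #< S -> A #< S -> add_omega A #< S.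
Proof.
move=> natS AS; have [fA|iA] := pselect (finite_set A).
  apply: card_le_lt_trans natS; apply: add_omega_le; first exact: infinite_nat.
  exact: finite_set_countable.
by apply: card_le_lt_trans AS; exact: add_omega_le.
Qed.

(** * Well-orders and transfinite recursion *)

Section WellOrder.
Context (K : eqType) (R : rel K).
Hypothesis wo : well_order R.

Lemma well_order_total : total R.
Proof.
have : wo_chain R predT by exact: withinW.
by move=> /wo_chainW h x y; exact: (h x y isT isT).
Qed.

Lemma well_order_antisym : antisymmetric R.
Proof.
have : wo_chain R predT by exact: withinW.
by move=> /wo_chain_antisymmetric h x y; exact: (h x y isT isT).
Qed.

Lemma well_order_least (P : set K) : P !=set0 ->
  exists2 z, P z & forall x, P x -> R z x.
Proof.
move=> [x Px]; have [|z [[/asboolP Pz zmin] _]] := wo (fun x => `[< P x >]).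
  by exists x; apply/asboolP.
by exists z => // y Py; apply: zmin; apply/asboolP.
Qed.

(** The least element of the triple is [x], or it forces two of the three points to coincide by
    antisymmetry. *)
Lemma well_order_trans : transitive R.
Proof.
move=> y x z Rxy Ryz.
have [|m mxyz mmin] := well_order_least [set t | [\/ t = x, t = y | t = z]].
  by exists x; constructor 1.
have Rmx : R m x by apply: mmin; constructor 1.
have Rmy : R m y by apply: mmin; constructor 2.
have Rmz : R m z by apply: mmin; constructor 3.
have anti a b : R a b -> R b a -> a = b.
  by move=> Rab Rba; apply: well_order_antisym; rewrite Rab.
case: mxyz => e; first by rewrite -e.
  by rewrite (anti x y) // -e.
by rewrite -(anti y z) // -e.
Qed.

Lemma well_order_wf : well_founded (fun x y => R x y /\ x <> y).
Proof.
move=> x; apply: contrapT => nx.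
have [|z nz zmin] := well_order_least (fun x => ~ Acc (fun x y => R x y /\ x <> y) x).
  by exists x.
apply: nz; constructor => y [Ryz yz]; apply: contrapT => /zmin Rzy.
by apply: yz; apply: well_order_antisym; rewrite Ryz.
Qed.

End WellOrder.

(** Plays the role of the initial ordinal of size |K|. If some proper initial segment of a
    well-order of [K] is as large as [K], cut at the least point having such a segment; otherwise
    keep all of [K]. *)
Lemma short_well_order (K : eqType) : exists (R : rel K) (S : set K),
  [/\ well_order R, [set: K] #<= S &
      forall s, S s -> [set t | R t s /\ t <> s] #< [set: K]].
Proof.
have [R wo] := well_ordering_principle K; exists R.
pose seg s := [set t | R t s /\ t <> s].
have [short|/existsNP long] := pselect (forall s, seg s #< [set: K]).
  by exists setT; split=> // s _; exact: short.
have [s slong smin] := well_order_least K R wo _ long.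
exists (seg s); split=> //.
  by move/negP: slong; rewrite card_ltNge negbK.
move=> t [Rts ts]; apply: contrapT => /smin Rst; apply: ts.
by apply: (well_order_antisym K R wo); rewrite Rts.
Qed.

(** Recursion in which each value is chosen in relation [P] to the set of earlier values. Where no
    choice is possible the value is [t0], hence the proviso on [q]. *)
Lemma wf_choice K (T : choiceType) (t0 : T) (lt : K -> K -> Prop) (P : set T -> T -> Prop) :
  well_founded lt -> exists y : K -> T, forall s,
    let A := y @` [set t | lt t s] in (exists q, P A q) -> P A (y s).
Proof.
move=> wf.
pose F s (rec : forall t, lt t s -> T) :=
  xget t0 (P [set q | exists t (h : lt t s), rec t h = q]).
pose y := Fix wf (fun=> T) F.
exists y => s A [q PAq].
have -> : y s = xget t0 (P A).
  rewrite /y Fix_eq => [|x f g fg]; last first.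
    congr F; apply: functional_extensionality_dep => t.
    exact: functional_extensionality_dep.
  rewrite /F; congr (xget _ (P _)); apply/seteqP; split=> p.
    by move=> [t [h <-]]; exists t.
  by move=> [t h <-]; exists t, h.
exact: xgetPex (ex_intro _ q PAq).
Qed.

(** * Bases and separated subspaces *)

Lemma subspace_basis (X : topologicalType) (A : set X) (B : set (set X)) :
  basis B -> @basis (set_type A) [set set_val @^-1` U | U in B].
Proof.
move=> [Bo Bb]; split.
  by move=> _ [U /Bo oU <-]; exists U.
move=> x W; rewrite nbhsE => -[_ [[V oV <-] Vx] VW].
have [U [BU Ux] UV] := Bb (set_val x) V (open_nbhs_nbhs (conj oV Vx)).
exists (set_val @^-1` U); first by split=> //; exists U.
by move=> y /UV; exact: VW.
Qed.

(* A basic set between z and g z determines z. *)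
Lemma weakly_separated_card_le (Z : topologicalType) (B : set (set Z)) :
  basis B -> weakly_separated Z -> [set: Z] #<= B.
Proof.
move=> [_ Bb] [g gZ gsep].
have /choice[b bP] : forall z, exists U, [/\ B U, U z & U `<=` g z].
  move=> z; have [U [BU Uz] Ug] := Bb z (g z) (open_nbhs_nbhs (gZ z I)).
  by exists U.
apply: (@card_le_inj _ _ _ _ b) => [z _|y z _ _ e]; first by have [] := bP z.
apply: contrapT => /gsep[]; apply.
  by have [_ _] := bP z; apply; rewrite -e; have [] := bP y.
by have [_ _] := bP y; apply; rewrite e; have [] := bP z.
Qed.

Lemma pseudo_weakly_separated_card_le (X : topologicalType) (B : set (set X))
    (Z : set X) :
  basis B -> pseudo_weakly_separated (set_type Z) -> Z #<= B.
Proof.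
move=> bB [A wA AZ].
(* [A] is a subspace of the subspace [Z], so the base is traced twice; traces are images and do not
   increase its size. *)
have := weakly_separated_card_le _ _ (subspace_basis _ A _ (subspace_basis _ Z _ bB)) wA.
move=> leAB; have : [set: A] #<= B.
  apply: (card_le_trans leAB); apply: (card_le_trans (card_image_le _ _)).
  exact: card_image_le.
rewrite (card_le_eql (card_setT A)) (card_le_eql AZ).
by rewrite (card_le_eql (card_setT Z)).
Qed.

(** Each point gets its closed initial segment as neighbourhood; of two distinct points, the later
    is not in the segment of the earlier. *)
Lemma right_separated_weakly_separated (Z : topologicalType) :
  right_separated Z -> weakly_separated Z.
Proof.
move=> [R wo Ro].
exists (fun z => [set x | R x z]).
  move=> z _; split; last by have := well_order_total _ _ wo z z; rewrite orbb.
  by apply: Ro => x y Ryz Rxy; exact: (well_order_trans _ _ wo) Rxy Ryz.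
move=> y z yz; have [Ryz|nR] := boolP (R y z); last by left; exact/negP.
by right=> Rzy; apply: yz; apply: (well_order_antisym _ _ wo); rewrite Ryz.
Qed.

Lemma weakly_separated_pseudo (Z : topologicalType) :
  weakly_separated Z -> pseudo_weakly_separated Z.
Proof.
move=> [g gZ gsep]; exists setT; last exact: card_eqxx.
exists (fun z => set_val @^-1` g (set_val z)).
  move=> z _; have [og gz] := gZ (set_val z) I.
  by split=> //; exists (g (set_val z)).
by move=> y z yz; apply: gsep => /val_inj.
Qed.

(** * From large weight to right-separated sets *)

Lemma weight_le (X : topologicalType) (B : set (set X)) :
  basis B -> weight X #<= add_omega B.
Proof. by have [C _ [-> Cmin]] := weightP X; exact: Cmin. Qed.

(** Each stage of the recursion picks such a pair [x], [U]. As weight counts [add_omega B],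
    uncountability of [A] is needed to keep this below [A]. *)
Lemma card_lt_not_basis (X : topologicalType) K (A : set K) (B : set (set X)) :
  [set: nat] #< A -> A #<= weight X -> B `<=` open -> B #< A ->
  exists x U, open_nbhs x U /\ forall V, B V -> V x -> ~ V `<=` U.
Proof.
move=> natA Aw Bo BA; apply: contrapT => nxU.
have : basis B.
  split=> // x W; rewrite nbhsE => -[U xU UW].
  apply: contrapT => nV; apply: nxU; exists x, U; split=> // V BV Vx VU.
  by apply: nV; exists V => //; exact: subset_trans UW.
move=> /weight_le /(card_le_trans Aw); apply/negP; rewrite -card_ltNge.
exact: add_omega_lt.
Qed.

(** The two alternatives on characters give the same bound: under regularity by definition, and
    under a uniform bound because the union has size at most the larger of |D| and the character of
    [X]. *)
Lemma card_lt_bigcup_local_base (X : topologicalType) K (LB : X -> set (set X)) :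
  (forall p, character_at p = add_omega (LB p)) ->
  character X #< [set: K] \/
    (regular_card [set: K] /\ forall p : X, character_at p #< [set: K]) ->
  forall (I : Type) (D : set I) (y : I -> X), D #< [set: K] ->
  \bigcup_(i in D) LB (y i) #< [set: K].
Proof.
move=> LBE hchi I D y DK.
have LBle p : LB p #<= character_at p by rewrite LBE; exact: card_le_add_omega.
case: hchi => [chiK|[regK chiK]]; last first.
  by apply: regular_bigcup_lt => // i _; exact: card_le_lt_trans (chiK (y i)).
have [ichi chile _] := characterP X.
have LBchi p : LB p #<= character X by exact: card_le_trans (chile p).
have [Dchi|chiD] := card_le_total _ _ D (character X).
  by apply: card_le_lt_trans chiK; exact: card_bigcup_le.
apply: card_le_lt_trans DK; apply: card_bigcup_le => // [|i _].
  exact: infinite_card_leN ichi chiD.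
exact: card_le_trans chiD.
Qed.

Lemma weight_ge_right_separated (K : eqType) (X : topologicalType) :
  character X #< [set: K] \/
    (regular_card [set: K] /\ forall p : X, character_at p #< [set: K]) ->
  [set: nat] #< [set: K] -> [set: K] #<= weight X ->
  exists (Y : set X) (f : X -> set X),
    [/\ Y #= [set: K], nbhd_assignment Y f &
        forall G : set X, open G -> right_separated (set_type (Dset Y f G))].
Proof.
move=> hchi natK Kw.
have /choice[LB LBP] : forall p : X, exists B, local_base p B /\ character_at p = add_omega B.
  by move=> p; have [B lB [e _]] := character_atP p; exists B.
have LBlt := card_lt_bigcup_local_base X K LB (fun p => (LBP p).2) hchi.
(* The empty family is not a base, so [X] has a point; it only feeds the default of the
   recursion. *)
have [x0 _] : exists (x : X) U, open_nbhs x U /\ forall V, set0 V -> V x -> ~ V `<=` U.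
  apply: (card_lt_not_basis _ _ _ _ natK Kw) => //.
  by apply: card_le_lt_trans natK; exact: card_ge0.
have [R [S [wo KS Sshort]]] := short_well_order K.
have Rtotal := well_order_total _ _ wo.
have [y yP] := wf_choice _ _ (x0, set0) _ (fun A q => open_nbhs q.1 q.2 /\
  forall V, (\bigcup_(p in A) LB p.1) V -> V q.1 -> ~ V `<=` q.2)
  (well_order_wf _ _ wo).
(* For [s] in [S] there are fewer than |K| earlier stages, so their local bases together are no base
   and the choice at [s] succeeds. *)
have {}yP s : S s -> open_nbhs (y s).1 (y s).2 /\
    forall t, R t s -> t <> s ->
    forall V, LB (y t).1 V -> V (y s).1 -> ~ V `<=` (y s).2.
  move=> Ss; have [|oy yV] := yP s.
    have [||x [U [xU UV]]] :=
        card_lt_not_basis _ _ _ (\bigcup_(t in [set t | R t s /\ t <> s]) LB (y t).1) natK Kw.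
    - by move=> V [t _ /(LBP _).1.1[]].
    - by apply: LBlt; exact: Sshort.
    by exists (x, U); split=> // V [_ [t ts <-] tV]; apply: UV; exists t.
  by split=> // t Rts ts V tV; apply: yV; exists (y t) => //; exists t.
(* Were a point chosen again at a later stage [s], its own local base would have a member inside the
   neighbourhood chosen at [s], which the choice excludes. *)
have yinj s t : S s -> S t -> (y s).1 = (y t).1 -> s = t.
  wlog Rts : s t / R t s => [hwlog Ss St e|Ss St e].
    by have /orP[|] := Rtotal s t => Rst; [symmetry|]; apply: hwlog.
  apply: contrapT => st; have [oy yV] := yP s Ss.
  have [|V tV VU] := (LBP (y t).1).1.2 (y s).2.
    by rewrite -e; exact: open_nbhs_nbhs.
  apply: (yV t Rts _ V tV _ VU); first by move=> /esym.
  by rewrite e; have [] := (LBP (y t).1).1.1 V tV.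
pose Y := [set (y s).1 | s in S].
have [k0 Sk0] : S !=set0.
  apply/infinite_setN0/infinite_card_leN/KS/infiniteP.
  by have /andP[] := natK.
have /choice[idx idxP] : forall x, exists s, Y x -> S s /\ (y s).1 = x.
  move=> x; have [[s Ss sx]|nx] := pselect (Y x); last by exists k0.
  by exists s.
exists Y, (fun x => (y (idx x)).2); split.
- have : Y #= S by apply: inj_card_eq => s t /set_mem Ss /set_mem; exact: yinj.
  move=> /card_eq_trans; apply; rewrite card_eq_le KS andbT.
  exact: card_leT.
- by move=> x /idxP[Ss e]; have [] := yP _ Ss; rewrite e.
move=> G oG; set D := Dset Y _ G.
(* [D] is ordered by the stages at which its points were chosen. *)
pose j (z : set_type D) := idx (val z).
have jP (z : set_type D) : [/\ S (j z), (y (j z)).1 = val z, G (val z) & G `<=` (y (j z)).2].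
  by have [Yz Gz GU] := set_mem (valP z); have [] := idxP _ Yz.
have jinj (z w : set_type D) : j z = j w -> z = w.
  move=> e; apply: val_inj; have [_ <- _ _] := jP z; have [_ <- _ _] := jP w.
  by rewrite e.
exists (fun z w => R (j z) (j w)).
  apply: antisymmetric_well_order => [z w /(well_order_antisym _ _ wo)/jinj//|A [a Aa]].
  have [|_ [z Az <-] zmin] := well_order_least _ _ wo (j @` [set` A]).
    by exists (j a), a.
  by exists z; split=> // w Aw; apply: zmin; exists w.
move=> S0 S0down; rewrite openE => z S0z.
have [Sz yz Gz GU] := jP z.
(* As [S0] is closed downwards, it suffices that the trace of [V] on [D] contains no point later
   than [z]. *)
have [|V zV VG] := (LBP (val z)).1.2 G; first exact: open_nbhs_nbhs.
have [oV Vz] := (LBP (val z)).1.1 V zV.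
rewrite /interior nbhsE; exists (set_val @^-1` V); first by split=> //; exists V.
move=> w Vw; have [Rwz|nRwz] := boolP (R (j w) (j z)); first exact: S0down Rwz.
have [Sw yw Gw GUw] := jP w.
have [_ /(_ (j z)) h] := yP _ Sw.
case: (h _ _ V).
- by have /orP[//|] := Rtotal (j z) (j w) => Rwz; rewrite Rwz in nRwz.
- by move=> e; move: nRwz; rewrite e; have := Rtotal (j w) (j w); rewrite orbb => ->.
- by rewrite yz.
- by rewrite yw.
- exact: subset_trans GUw.
Qed.

(** * The regular cardinal lambda, and the way back to weight *)

Lemma regular_card_countable T (A : set T) :
  infinite_set A -> countable A -> regular_card A.
Proof.
move=> iA cA.
have ltA U (B : set U) : (B #< A) <-> finite_set B.
  rewrite card_ltNge; split=> [nAB|fB].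
    apply: contrapT => /infiniteP natB; move/negP: nAB; apply.
    exact: card_le_trans cA natB.
  by apply/negP => leAB; apply: iA; exact: card_le_finite leAB fB.
split=> // I F /ltA fI FA; apply/ltA/bigcup_finite => // i Ii.
exact/ltA/FA.
Qed.

Lemma infinite_countable_subset T (A : set T) : infinite_set A ->
  exists L : set T, [/\ L `<=` A, infinite_set L & countable L].
Proof.
move=> iA; have [a _] := infinite_setN0 iA.
have /infiniteP/(card_le_fun _ _ _ _ a)[f [fA finj]] := iA.
exists (range f); split.
- by move=> _ [n _ <-]; exact: fA.
- apply/infiniteP; have : range f #= [set: nat].
    by apply: inj_card_eq => x z _ _; exact: finj.
  by rewrite card_eq_le => /andP[].
- exact: card_image_le.
Qed.

Lemma pseudo_weakly_separated_weight_ge K (X : topologicalType) (Y : set X)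
    (f : X -> set X) (L : set K) :
  Y #= [set: K] -> nbhd_assignment Y f -> regular_card L ->
  (forall G : set X, open G -> exists P : set (set X),
     [/\ P #< L, forall Z, P Z -> pseudo_weakly_separated (set_type Z) &
         Dset Y f G = \bigcup_(Z in P) Z]) ->
  [set: K] #<= weight X.
Proof.
move=> YK Yf regL hP; have [B bB [-> _]] := weightP X.
rewrite -[_ #<= _]negbK -card_ltNge; apply/negP => BK.
have iB := infinite_add_omega _ B.
have BB := card_le_add_omega _ B.
(* A basic [b] with [x] in [b] and [b] inside [f x] puts [x] in [Dset Y f b]. *)
have YD : Y `<=` \bigcup_(b in B) Dset Y f b.
  move=> x Yx; have [b [Bb bx] bf] := bB.2 x (f x) (open_nbhs_nbhs (Yf x Yx)).
  by exists b.
have KY : [set: K] #<= \bigcup_(b in B) Dset Y f b.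
  move: YK; rewrite card_eq_le => /andP[_ KY].
  exact: card_le_trans KY (subset_card_le YD).
(* If lambda < kappa, then [M], the larger of |B| + aleph_0 and lambda, is still below kappa and
   bounds the number of pieces and their sizes, so kappa need not be regular. The sum type only
   gives both candidates a common home. *)
have [LK|KL] := boolP (L #< [set: K]).
  have [M [iM BM LM MK]] : exists M : set (nat + set X + K),
      [/\ infinite_set M, add_omega B #<= M, L #<= M & M #< [set: K]].
    have [BL|LB] := card_le_total _ _ (add_omega B) L.
      exists (inr @` L).
      have : @inr (nat + set X) K @` L #= L by apply: inj_card_eq => ? ? _ _ [].
      rewrite card_eq_le => /andP[h1 h2]; split=> //.
      + by apply: infinite_card_leN h2; have [] := regL.
      + exact: card_le_trans h2.
      + exact: card_le_lt_trans LK.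
    exists (inl @` add_omega B).
    have : @inl (nat + set X) K @` add_omega B #= add_omega B.
      by apply: inj_card_eq => ? ? _ _ [].
    rewrite card_eq_le => /andP[h1 h2]; split=> //.
    + exact: infinite_card_leN h2.
    + exact: card_le_trans h2.
    + exact: card_le_lt_trans BK.
  move: MK; rewrite card_ltNge => /negP; apply; apply: (card_le_trans KY).
  apply: card_bigcup_le => // [|b Bb]; first exact: card_le_trans BM.
  have [P [PL Pws ->]] := hP b (bB.1 _ Bb).
  apply: card_bigcup_le => // [|Z PZ].
    by have /andP[PleL _] := PL; exact: card_le_trans LM.
  apply: card_le_trans BM; apply: card_le_trans BB.
  exact/(pseudo_weakly_separated_card_le _ _ _ bB)/Pws.
(* Otherwise lambda = kappa, and regularity of [L] is applied twice: to the pieces of one [Dset],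
   then to the union over [B]. *)
move: KL; rewrite card_ltNge negbK => KL.
have BL : B #< L.
  apply: (card_le_lt_trans _ _ _ _ _ _ BB).
  move: BK; rewrite !card_ltNge; apply: contra; exact: card_le_trans.
have : \bigcup_(b in B) Dset Y f b #< L.
  apply: regular_bigcup_lt => // b Bb.
  have [P [PL Pws ->]] := hP b (bB.1 _ Bb).
  apply: regular_bigcup_lt => // Z PZ; apply: card_le_lt_trans BL.
  exact/(pseudo_weakly_separated_card_le _ _ _ bB)/Pws.
rewrite card_ltNge => /negP; apply; apply: card_le_trans KY.
exact: card_leT.
Qed.

(* kappa is the cardinality of K, and a cardinal lambda <= kappa is that of a
   subset L of K. The last hypothesis follows from the previous one except when
   X is empty and K is countable, where (a) holds and (b) fails. *)
Theorem theorem2p14 (K : Type) (X : topologicalType)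
    (hchi : character X #< [set: K] \/
            (regular_card [set: K] /\ forall p : X, character_at p #< [set: K]))
    (hX : [set: X] !=set0 \/ [set: nat] #< [set: K]) :
  [<-> (* a *) [set: K] #<= weight X;
       (* b *) exists (Y : set X) (f : X -> set X),
         [/\ Y #= [set: K],
             nbhd_assignment Y f &
             forall G : set X, open G -> right_separated (set_type (Dset Y f G))];
       (* c *) exists (Y : set X) (f : X -> set X) (L : set K),
         [/\ Y #= [set: K],
             nbhd_assignment Y f,
             regular_card L &
             forall G : set X, open G ->
               exists P : set (set X),
                 [/\ P #< L,
                     forall Z, P Z -> pseudo_weakly_separated (set_type Z) &
                     Dset Y f G = \bigcup_(Z in P) Z]]].
Proof.
(* At any point of [X] the character is infinite and below kappa, so kappa is uncountable. *)
have natK : [set: nat] #< [set: K].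
  case: hX => // -[x _]; have chiK : character_at x #< [set: K].
    case: hchi => [|[_]//]; apply: card_le_lt_trans.
    by have [] := characterP X.
  apply: card_le_lt_trans chiK; apply/infiniteP.
  by have [B _ [-> _]] := character_atP x; exact: infinite_add_omega.
have iK : infinite_set [set: K] by apply/infiniteP; case/andP: natK.
tfae.
(* [{classic K}] equips [K] with the decidable equality that well-orders require. *)
- exact: (@weight_ge_right_separated {classic K}).
- move=> [Y [f [YK Yf Yrs]]].
  have [L [_ iL cL]] := infinite_countable_subset _ _ iK.
  exists Y, f, L; split=> //; first exact: regular_card_countable.
  (* [Dset Y f G] is itself the only piece, and one is less than lambda = aleph_0. *)
  move=> G oG; exists [set Dset Y f G]; split.
  + rewrite card_ltNge; apply/negP => /card_le_finite h.
    by apply/iL/h/finite_set1.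
  + move=> _ ->; apply: weakly_separated_pseudo.
    exact/right_separated_weakly_separated/Yrs.
  + by rewrite bigcup_set1.
- move=> [Y [f [L [YK Yf regL hP]]]].
  exact: pseudo_weakly_separated_weight_ge YK Yf regL hP.
Qed.
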